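(* Let $p,q,r$ be positive integers and $k_1,\ldots,k_r$ integers $\ge2$; put $|\mathbf{k}|=k_1+\cdots+k_r$ and $K_j=k_r+k_{r-1}+\cdots+k_{r+1-j}$ for $0\le j\le r$ ($K_0=0$). Then \[ \psi(\{1\}_{q-1},k_1,\ldots,k_{r-1},k_r-1;p+1)-(-1)^{|\mathbf{k}|}\psi(\{1\}_{p-1},k_r,\ldots,k_2,k_1-1;q+1) \] \[ =\sum_{j=0}^{r-1}(-1)^{K_j}\sum_{i=1}^{k_{r-j}-2}(-1)^{i-1}T(\{1\}_{p-1},k_r,\ldots,k_{r+1-j},i+1)\,T(\{1\}_{q-1},k_1,\ldots,k_{r-j-1},k_{r-j}-i) \] \[ +\sum_{j=0}^{r-2}(-1)^{K_{j+1}}\lim_{x\to1^-}\Big\{{\rm A}(\mathbf{a}_j;x){\rm A}(\mathbf{b}_j,1;x)-{\rm A}(\mathbf{a}_j,1;x){\rm A}(\mathbf{b}_j;x)\Big\}, \] where $\mathbf{a}_j=(\{1\}_{p-1},k_r,k_{r-1},\ldots,k_{r-j})$, $\mathbf{b}_j=(\{1\}_{q-1},k_1,\ldots,k_{r-j-1})$, and sequences such as $k_r,\ldots,k_{r+1-j}$ (for $j=0$) or $k_1,\ldots,k_{r-j-1}$ (for $j=r-1$) are empty.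
   Context: ${\rm A}(k_1,\ldots,k_r;z)=2^r\sum_{1\le n_1<\cdots<n_r,\ n_i\equiv i \pmod 2}\frac{z^{n_r}}{n_1^{k_1}\cdots n_r^{k_r}}$ for $z\in[-1,1)$; $\psi(k_1,\ldots,k_r;s)=\frac{1}{\Gamma(s)}\int_0^\infty t^{s-1}\frac{{\rm A}(k_1,\ldots,k_r;\tanh(t/2))}{\sinh t}\,dt$. For admissible $(k_1,\ldots,k_r)$ ($k_r\ge2$), $T(k_1,\ldots,k_r)=2^r\sum_{0<m_1<\cdots<m_r,\ m_i\equiv i\pmod 2}\frac{1}{m_1^{k_1}\cdots m_r^{k_r}}$. $\{1\}_j$ denotes $j$ repetitions of $1$. *)

(* Defs.v *)
From Stdlib Require Import Reals List Arith.
From Coquelicot Require Import Coquelicot.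
Import ListNotations.

Open Scope R_scope.

(* sum_list l f = \sum_{i \in l} f i (with multiplicity). *)
Definition sum_list (l : list nat) (f : nat -> R) : R :=
  fold_right Rplus 0 (map f l).

(* An index (k_1, ..., k_r) is the list [k_1; ...; k_r].  [nested_sum] takes it
   reversed, with the outermost variable n_r first:
     nested_sum [k_r; ...; k_1] w N =
       \sum_{1 <= n_1 < ... < n_r <= N, n_i = i mod 2}
          w(n_r) / (n_1^{k_1} ... n_r^{k_r}).
   The parity required of n_r is that of r, the length of the list; the inner
   call runs over the tuples with n_{r-1} <= n_r - 1. *)
Fixpoint nested_sum (rks : list nat) (w : nat -> R) (N : nat) : R :=
  match rks with
  | [] => 1
  | k :: rks' =>
      sum_list
        (filter (fun n => Bool.eqb (Nat.even n) (Nat.even (length rks)))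
                (seq 1 N))
        (fun n => w n / INR n ^ k * nested_sum rks' (fun _ => 1) (n - 1))
  end.

(* The infinite sums are limits of the truncations n_r <= N, which is also the
   meaning of A where it converges only conditionally (z = -1, k_r = 1).
   A is meant for z in [-1, 1), T for k_r >= 2. *)
Definition A (ks : list nat) (z : R) : R :=
  2 ^ length ks * real (Lim_seq (nested_sum (rev ks) (fun n => z ^ n))).

Definition T (ks : list nat) : R :=
  2 ^ length ks * real (Lim_seq (nested_sum (rev ks) (fun _ => 1))).

Definition Gamma (s : R) : R :=
  RInt_gen (fun t => Rpower t (s - 1) * exp (- t))
           (at_right 0) (Rbar_locally p_infty).

Definition psi (ks : list nat) (s : R) : R :=
  / Gamma s *
  RInt_gen (fun t => Rpower t (s - 1) * (A ks (tanh (t / 2)) / sinh t))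
           (at_right 0) (Rbar_locally p_infty).

Definition ones (n : nat) : list nat := repeat 1%nat n.

(* k_1, ..., k_n *)
Definition fwd (k : nat -> nat) (n : nat) : list nat := map k (seq 1 n).

(* k_r, k_{r-1}, ..., k_{r+1-j} *)
Definition bwd (k : nat -> nat) (r j : nat) : list nat :=
  map (fun i => k (r - i)%nat) (seq 0 j).

(* K_j = k_r + ... + k_{r+1-j} *)
Definition Ksum (k : nat -> nat) (r j : nat) : nat := list_sum (bwd k r j).

Definition idx_a (p r : nat) (k : nat -> nat) (j : nat) : list nat :=
  ones (p - 1) ++ bwd k r (j + 1).

Definition idx_b (q r : nat) (k : nat -> nat) (j : nat) : list nat :=
  ones (q - 1) ++ fwd k (r - j - 1).

(* Main.v *)
(* In the coordinate z = tanh(t/2) put F_k(t) = A(k; tanh(t/2)).  Then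
   F_(k,1)' = F_k and F_(k_1,..,k_r + 1)' = F_(k_1,..,k_r) / sinh t, hence
   F_({1}_p) = t^p / p! and psi(k; p + 1) is the integral over (0, oo) of
   F_({1}_p) F_k / sinh.  Integrating by parts moves units one at a time from
   the last entry of one index to the last entry of the other, which produces
   the products T T; when that entry reaches 1, two further integrations by parts
   (whose integrals of F_a F_b cancel) move to the next entry, which produces the
   limits.  All integrals converge since F_k <= t^r / r!. *)
Require Import Defs.
From Stdlib Require Import Reals List Arith Lra Lia Classical.
From Coquelicot Require Import Coquelicot.
Import ListNotations.
Open Scope R_scope.

(** The obstacle is convergence at t = oo. Each product inside the braces grows linearly in t,
    because F_(b,1) has derivative F_b, which tends to T(b) > 0; only the difference has a limit.
    Its existence is therefore not deduced from limits of the factors: the derivative of the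
    difference is itself a difference of two integrands of the shape F_a F_b / sinh, and the limit
    is the difference of their integrals. Integrability of F_a F_b / sinh, for a and b not both
    empty, thus carries the whole analysis, including the finiteness of T. Since sinh vanishes at 0,
    primitives live on the open half line and are normalised by their limit at 0+. *)

(** * Power series of A: coefficients, growth and differential recursions *)

(* Power series coefficients of A; the delta function for the empty index makes
   the recursions below uniform. *)
Definition coef (l : list nat) (n : nat) : R :=
  match l with
  | [] => if n =? 0 then 1 else 0
  | k :: l' =>
      if (1 <=? n) && Bool.eqb (Nat.even n) (Nat.even (length l))
      then nested_sum l' (fun _ => 1) (n - 1) / INR n ^ k else 0
  end%bool.

Lemma sum_list_app (l1 l2 : list nat) f :
  sum_list (l1 ++ l2) f = sum_list l1 f + sum_list l2 f.
Proof.
  unfold sum_list. induction l1 as [|a l1 IH]; simpl; [ring|]. rewrite IH; ring.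
Qed.

Lemma nested_sum_cons_S k l w N :
  nested_sum (k :: l) w (S N) =
  nested_sum (k :: l) w N + coef (k :: l) (S N) * w (S N).
Proof.
  cbn [nested_sum]. rewrite seq_S, filter_app, sum_list_app. f_equal.
  cbn [filter Nat.add]. unfold coef. change (1 <=? S N) with true.
  destruct (Bool.eqb _ _); cbn [andb]; unfold sum_list; cbn [map fold_right];
    unfold Rdiv; ring.
Qed.

(** The only coefficient of the empty index sits at n = 0, so the weight there has to be 1 to match
    the value 1 of the empty nested sum; the weights z ^ n satisfy this even at z = 0. *)
Lemma nested_sum_coef l w N : w 0%nat = 1 ->
  nested_sum l w N = sum_n (fun n => coef l n * w n) N.
Proof.
  intros Hw. destruct l as [|k l].
  - simpl. induction N as [|N IH].
    + rewrite sum_O. simpl. rewrite Hw; ring.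
    + rewrite sum_Sn, <- IH. simpl. unfold plus; simpl. ring.
  - induction N as [|N IH].
    + rewrite sum_O. simpl. unfold sum_list; simpl. ring.
    + rewrite nested_sum_cons_S, IH, sum_Sn. reflexivity.
Qed.

Lemma nested_sum_1_S l N :
  nested_sum l (fun _ => 1) (S N) = nested_sum l (fun _ => 1) N + coef l (S N).
Proof.
  destruct l as [|k l]; [simpl; ring|]. rewrite nested_sum_cons_S; ring.
Qed.

Lemma coef_0 l : coef l 0 = match l with [] => 1 | _ => 0 end.
Proof. now destruct l. Qed.

Lemma nested_sum_1_0 l : nested_sum l (fun _ => 1) 0 = coef l 0.
Proof. rewrite nested_sum_coef by easy. rewrite sum_O; ring. Qed.

Lemma coef_parity l n :
  Bool.eqb (Nat.even n) (Nat.even (length l)) = false -> coef l n = 0.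
Proof.
  destruct l as [|k l]; intros H.
  - destruct n; [discriminate|reflexivity].
  - unfold coef. rewrite H. now rewrite Bool.andb_false_r.
Qed.

Lemma A_PSeries ks z :
  A ks z = 2 ^ length ks * PSeries (coef (rev ks)) z.
Proof.
  unfold A, PSeries, Series. do 2 f_equal.
  apply Lim_seq_ext; intros n. apply nested_sum_coef. reflexivity.
Qed.

Definition positive_index (l : list nat) : Prop := List.Forall (fun k => (1 <= k)%nat) l.

(** Raising an exponent only shrinks a term, so among indices of a given length the one made of ones
    is the largest. Coefficients and truncated sums are treated together, since the coefficients for
    [k :: l] are built from the truncated sums for [l]. *)
Lemma coef_nested_sum_bounds l : positive_index l ->
  (forall n, 0 <= coef l n <= coef (ones (length l)) n) /\
  (forall N, 0 <= nested_sum l (fun _ => 1) N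
             <= nested_sum (ones (length l)) (fun _ => 1) N).
Proof.
  intros H; induction H as [|k l Hk _ [_ IH]].
  - split; intros n; simpl; [destruct n; simpl; lra | lra].
  - assert (Hc : forall n, 0 <= coef (k :: l) n <= coef (ones (length (k :: l))) n).
    { intros n. unfold ones in *; cbn [length repeat]; unfold coef.
      cbn [length]. rewrite repeat_length.
      destruct (Nat.leb_spec 1 n) as [Hn|]; cbn [andb]; [|lra].
      destruct (Bool.eqb _ _); [|lra].
      specialize (IH (n - 1)%nat).
      assert (Hn1 : 1 <= INR n) by (apply (le_INR 1); lia).
      assert (Hnk : INR n ^ 1 <= INR n ^ k) by now apply Rle_pow.
      unfold Rdiv. split.
      - apply Rmult_le_pos; [apply IH|]. apply Rlt_le, Rinv_0_lt_compat.
        simpl in Hnk; lra.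
      - apply Rmult_le_compat; try apply IH.
        + apply Rlt_le, Rinv_0_lt_compat. simpl in Hnk; lra.
        + apply Rinv_le_contravar; [simpl; lra|exact Hnk]. }
    split; [exact Hc|]. induction N as [|N IHN].
    + rewrite !nested_sum_1_0; apply Hc.
    + rewrite !nested_sum_1_S. specialize (Hc (S N)). lra.
Qed.

Lemma coef_nonneg l n : positive_index l -> 0 <= coef l n.
Proof. intros H; apply (coef_nested_sum_bounds l H). Qed.

Lemma nested_sum_nonneg l N : positive_index l -> 0 <= nested_sum l (fun _ => 1) N.
Proof. intros H; apply (coef_nested_sum_bounds l H). Qed.

Lemma ones_positive n : positive_index (ones n).
Proof. apply List.Forall_forall; intros x Hx. apply repeat_spec in Hx; lia. Qed.

(** Crude polynomial growth, obtained by dropping the denominators; it is enough to place the radius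
    of convergence at 1 or beyond. *)
Lemma coef_le_pow l : positive_index l ->
  (forall n, coef l n <= (INR n + 1) ^ length l) /\
  (forall N, nested_sum l (fun _ => 1) N <= (INR N + 1) ^ length l).
Proof.
  intros H; induction H as [|k l Hk Hl [_ IH]].
  - split; intros n; simpl; [destruct n; simpl; lra | lra].
  - assert (Hc : forall n, coef (k :: l) n <= INR n ^ length l).
    { intros n. assert (H0 := pos_INR n). unfold coef.
      destruct (Nat.leb_spec 1 n) as [Hn|]; cbn [andb];
        [|now apply pow_le].
      destruct (Bool.eqb _ _); [|now apply pow_le].
      assert (Hn1 : 1 <= INR n) by (apply (le_INR 1); lia).
      assert (Hnk := pow_R1_Rle (INR n) k Hn1).
      apply Rle_trans with (nested_sum l (fun _ => 1) (n - 1)).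
      - rewrite <- (Rmult_1_r (nested_sum _ _ _)) at 2.
        apply Rmult_le_compat_l; [now apply nested_sum_nonneg|].
        rewrite <- Rinv_1. apply Rinv_le_contravar; lra.
      - eapply Rle_trans; [apply IH|]. rewrite minus_INR by lia.
        simpl (INR 1). right; f_equal; ring. }
    assert (Hmono : forall m : nat,
              INR m ^ length l <= (INR m + 1) ^ length l).
    { intros m. apply pow_incr. assert (H0 := pos_INR m). lra. }
    split.
    + intros n. eapply Rle_trans; [apply Hc|]. eapply Rle_trans; [apply Hmono|].
      simpl. assert (H0 := pos_INR n).
      assert (0 <= (INR n + 1) ^ length l) by (apply pow_le; lra). nra.
    + induction N as [|N IHN].
      * simpl. unfold sum_list; simpl.
        assert (0 <= (0 + 1) ^ length l) by (apply pow_le; lra). nra.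
      * rewrite nested_sum_1_S. specialize (Hc (S N)). rewrite S_INR in *.
        assert (H0 := pos_INR N). specialize (Hmono (S N)). rewrite S_INR in *.
        assert ((INR N + 1) ^ length l <= (INR N + 1 + 1) ^ length l)
          by (apply pow_incr; lra).
        cbn [length pow] in IHN |- *.
        apply Rle_trans with ((INR N + 1 + 1) * (INR N + 1) ^ length l); [lra|].
        apply Rmult_le_compat_l; lra.
Qed.

(** A single term of the exponential series is at most its sum. *)
Lemma pow_le_fact_exp n t : 0 <= t -> t ^ n <= INR (fact n) * exp t.
Proof.
  intros Ht. assert (Hf := INR_fact_lt_0 n).
  assert (H : t ^ n / INR (fact n) <= exp t).
  { eapply Rle_trans; [|apply (exp_ge_taylor t n Ht)].
    assert (Hp : forall m, 0 <= t ^ m / INR (fact m)).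
    { intros m. apply Rle_mult_inv_pos; [now apply pow_le|apply INR_fact_lt_0]. }
    destruct n as [|n]; [simpl; lra|]. rewrite tech5.
    assert (H := cond_pos_sum _ n Hp). lra. }
  apply (Rmult_le_compat_l (INR (fact n))) in H; [|lra].
  replace (INR (fact n) * (t ^ n / INR (fact n))) with (t ^ n) in H; [exact H|].
  field; lra.
Qed.

Lemma CV_radius_coef l : positive_index l -> Rbar_le 1 (CV_radius (coef l)).
Proof.
  intros Hl. destruct (CV_radius_bounded (coef l)) as [Hub _].
  assert (H : forall r, 0 < r < 1 -> Rbar_le r (CV_radius (coef l))).
  { intros r Hr. apply Hub.
    set (e := - ln r).
    assert (He : 0 < e).
    { assert (H : ln r < ln 1) by (apply ln_increasing; lra).
      rewrite ln_1 in H. unfold e; lra. }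
    assert (Hre : r = exp (- e)) by (unfold e; rewrite Ropp_involutive, exp_ln; lra).
    (* With r = exp (- e) and m the length, the exponential bound at e (n + 1) reads e^m (n + 1)^m
       <= m! exp e r^(-n), whence this constant. *)
    exists (INR (fact (length l)) * exp e / e ^ length l). intros n.
    assert (Hrn : r ^ n = exp (- (e * INR n))).
    { rewrite <- Rpower_pow by lra. unfold Rpower. f_equal. unfold e; ring. }
    rewrite Rabs_right.
    2:{ apply Rle_ge, Rmult_le_pos; [now apply coef_nonneg|apply pow_le; lra]. }
    apply Rle_trans with ((INR n + 1) ^ length l * r ^ n).
    { apply Rmult_le_compat_r; [apply pow_le; lra|].
      now apply (proj1 (coef_le_pow l Hl)). }
    assert (Hep : 0 < e ^ length l) by now apply pow_lt.
    apply Rmult_le_reg_l with (e ^ length l); [exact Hep|].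
    replace (e ^ length l * (INR (fact (length l)) * exp e / e ^ length l))
      with (INR (fact (length l)) * exp e) by (field; lra).
    rewrite <- Rmult_assoc, <- Rpow_mult_distr.
    assert (Hn := pos_INR n).
    eapply Rle_trans.
    { apply Rmult_le_compat_r; [apply pow_le; lra|].
      apply pow_le_fact_exp. nra. }
    rewrite Hrn, Rmult_assoc, <- exp_plus. right. do 2 f_equal. ring. }
  destruct (CV_radius (coef l)) as [c| |] eqn:E; simpl.
  - apply Rnot_lt_le; intros Hc.
    assert (H0 := CV_radius_ge_0 (coef l)). rewrite E in H0; simpl in H0.
    specialize (H ((c + 1) / 2)). simpl in H. lra.
  - exact I.
  - specialize (H (1 / 2)). simpl in H. apply H; lra.
Qed.

Lemma CV_radius_coef_lt l x : positive_index l -> Rabs x < 1 ->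
  Rbar_lt (Rabs x) (CV_radius (coef l)).
Proof.
  intros Hl Hx. apply Rbar_lt_le_trans with 1; [exact Hx|now apply CV_radius_coef].
Qed.

Lemma ex_series_coef l x : positive_index l -> Rabs x < 1 ->
  ex_series (fun n => coef l n * x ^ n).
Proof.
  intros Hl Hx. apply ex_pseries_R, CV_radius_inside. now apply CV_radius_coef_lt.
Qed.

(** The operator x d/dx multiplies the n-th coefficient by n, which lowers the last exponent by one
    and keeps the length, hence the parity condition. *)
Lemma PSeries_derive_coef_S k l x :
  x * PSeries (PS_derive (coef (S k :: l))) x = PSeries (coef (k :: l)) x.
Proof.
  rewrite <- PSeries_incr_1. apply PSeries_ext. intros [|n]; [reflexivity|].
  unfold PS_incr_1, PS_derive, coef. cbn [length].
  destruct (_ && _)%bool; [|ring].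
  assert (H : INR (S n) <> 0) by now apply not_0_INR.
  assert (INR (S n) ^ k <> 0) by now apply pow_nonzero.
  cbn [pow]. field. tauto.
Qed.

(* Writing d for the coefficients of the derivative, d(n) - d(n - 2) = coef l n
   because [coef l] is supported on one parity class. *)
Lemma PSeries_derive_coef_1 l x : positive_index l -> Rabs x < 1 ->
  (1 - x * x) * PSeries (PS_derive (coef (1%nat :: l))) x = PSeries (coef l) x.
Proof.
  intros Hl Hx. set (d := PS_derive _).
  assert (Hd : forall n, d n = if Bool.eqb (Nat.even n) (Nat.even (length l))
                       then nested_sum l (fun _ => 1) n else 0).
  { intros n. unfold d, PS_derive, coef. cbn [length Nat.leb andb].
    rewrite !Nat.even_succ, <- !Nat.negb_even.
    replace (Bool.eqb (negb (Nat.even n)) (negb (Nat.even (length l))))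
      with (Bool.eqb (Nat.even n) (Nat.even (length l)))
      by now destruct (Nat.even n), (Nat.even (length l)).
    destruct (Bool.eqb _ _); [|ring].
    replace (S n - 1)%nat with n by lia.
    field. now apply not_0_INR. }
  assert (Hex : ex_pseries d x).
  { apply CV_radius_inside. unfold d. rewrite CV_radius_derive.
    apply CV_radius_coef_lt; [|exact Hx]. now constructor. }
  replace ((1 - x * x) * PSeries d x) with
    (PSeries d x - PSeries (PS_incr_1 (PS_incr_1 d)) x)
    by (rewrite !PSeries_incr_1; ring).
  rewrite <- PSeries_minus; [|exact Hex|now do 2 apply ex_pseries_incr_1].
  apply PSeries_ext. intros n.
  unfold PS_minus, PS_plus, PS_opp, plus, opp; simpl.
  destruct n as [|[|n]]; unfold PS_incr_1; rewrite !Hd.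
  - rewrite nested_sum_1_0. change (@zero R_NormedModule) with 0.
    destruct (Bool.eqb _ _) eqn:E; [|rewrite (coef_parity l 0 E)]; ring.
  - rewrite nested_sum_1_S, nested_sum_1_0. change (@zero R_NormedModule) with 0.
    destruct (Bool.eqb _ _) eqn:E; [|rewrite (coef_parity l 1 E); ring].
    rewrite (coef_parity l 0); [ring|].
    cbn in *. now destruct (Nat.even (length l)).
  - rewrite !nested_sum_1_S. cbn [Nat.even].
    destruct (Bool.eqb _ _) eqn:E; [|rewrite (coef_parity l (S (S n)) E); ring].
    rewrite (coef_parity l (S n)); [ring|].
    rewrite Nat.even_succ, <- Nat.negb_even.
    now destruct (Nat.even n), (Nat.even (length l)).
Qed.

(** * The functions F_k in the coordinate t *)

(** This is F_k. For z = tanh (t / 2) one has dz / z = dt / sinh t and dz / (1 - z^2) = dt / 2, so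
    the two recursions above become sinh t d/dt and d/dt; the factor 2^r in A absorbs the 1/2. *)
Definition Ah (ks : list nat) (t : R) : R := A ks (tanh (t / 2)).

Lemma cosh_pos t : 0 < cosh t.
Proof. unfold cosh. assert (H1 := exp_pos t); assert (H2 := exp_pos (- t)). lra. Qed.

Lemma sinh_pos t : 0 < t -> 0 < sinh t.
Proof.
  intros Ht. unfold sinh. assert (H : exp (- t) < exp t) by (apply exp_increasing; lra).
  lra.
Qed.

Lemma tanh_Rabs_lt t : Rabs (tanh t) < 1.
Proof.
  assert (Hc := cosh_pos t). unfold tanh. apply Rabs_def1.
  - apply Rmult_lt_reg_r with (cosh t); [exact Hc|]. unfold Rdiv.
    rewrite Rmult_assoc, Rinv_l by lra. unfold sinh, cosh.
    assert (H := exp_pos (- t)). lra.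
  - apply Rmult_lt_reg_r with (cosh t); [exact Hc|]. unfold Rdiv.
    rewrite Rmult_assoc, Rinv_l by lra. unfold sinh, cosh.
    assert (H := exp_pos t). lra.
Qed.

Lemma tanh_pos t : 0 < t -> 0 < tanh t.
Proof.
  intros Ht. unfold tanh. apply Rdiv_lt_0_compat; [now apply sinh_pos|apply cosh_pos].
Qed.

Lemma tanh_nonneg t : 0 <= t -> 0 <= tanh t.
Proof.
  intros [Ht|<-]; [now apply Rlt_le, tanh_pos|]. unfold tanh. rewrite sinh_0.
  unfold Rdiv; lra.
Qed.

Lemma cosh2_sinh2 t : cosh t * cosh t - sinh t * sinh t = 1.
Proof.
  unfold cosh, sinh. assert (H : exp t * exp (- t) = 1).
  { rewrite <- exp_plus, Rplus_opp_r. apply exp_0. }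
  replace ((exp t + exp (- t)) / 2 * ((exp t + exp (- t)) / 2) -
    (exp t - exp (- t)) / 2 * ((exp t - exp (- t)) / 2))
    with (exp t * exp (- t)) by field. exact H.
Qed.

Lemma sinh_half t : sinh t = 2 * (sinh (t / 2) * cosh (t / 2)).
Proof.
  unfold sinh, cosh.
  replace (exp t) with (exp (t / 2) * exp (t / 2))
    by (rewrite <- exp_plus; f_equal; field).
  replace (exp (- t)) with (exp (- (t / 2)) * exp (- (t / 2)))
    by (rewrite <- exp_plus; f_equal; field).
  field.
Qed.

Lemma is_derive_tanh_half t :
  is_derive (fun t => tanh (t / 2)) t
    ((1 - tanh (t / 2) * tanh (t / 2)) / 2).
Proof.
  unfold tanh, sinh, cosh.
  assert (H : exp (t / 2) + exp (- (t / 2)) > 0)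
    by (assert (H1 := exp_pos (t / 2)); assert (H2 := exp_pos (- (t / 2))); lra).
  auto_derive.
  - lra.
  - unfold Rdiv in *. field. lra.
Qed.

Lemma PSeries_tanh_half_derive a t :
  Rbar_le 1 (CV_radius a) ->
  is_derive (fun t => PSeries a (tanh (t / 2))) t
    ((1 - tanh (t / 2) * tanh (t / 2)) / 2 * PSeries (PS_derive a) (tanh (t / 2))).
Proof.
  intros Ha. apply (is_derive_comp (PSeries a) (fun t => tanh (t / 2))).
  - apply is_derive_PSeries. eapply Rbar_lt_le_trans; [|exact Ha].
    apply tanh_Rabs_lt.
  - apply is_derive_tanh_half.
Qed.

Lemma Ah_derive_1 ks t : positive_index ks ->
  is_derive (Ah (ks ++ [1%nat])) t (Ah ks t).
Proof.
  intros Hks.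
  assert (Hrev : positive_index (rev ks)) by now apply Forall_rev.
  apply is_derive_ext with
    (fun t => 2 ^ length (ks ++ [1%nat]) * PSeries (coef (1%nat :: rev ks)) (tanh (t / 2))).
  { intros s. unfold Ah. rewrite A_PSeries, rev_app_distr. reflexivity. }
  unfold Ah. rewrite A_PSeries.
  rewrite <- PSeries_derive_coef_1 by (trivial; apply tanh_Rabs_lt).
  replace (2 ^ length ks * _) with
    (2 ^ length (ks ++ [1%nat]) * ((1 - tanh (t / 2) * tanh (t / 2)) / 2 *
      PSeries (PS_derive (coef (1%nat :: rev ks))) (tanh (t / 2)))).
  2:{ rewrite length_app, Nat.add_comm. simpl. field. }
  apply is_derive_scal, PSeries_tanh_half_derive, CV_radius_coef. now constructor.
Qed.

Lemma Ah_derive_S ks k t : positive_index ks -> (1 <= k)%nat -> 0 < t ->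
  is_derive (Ah (ks ++ [S k])) t (Ah (ks ++ [k]) t / sinh t).
Proof.
  intros Hks Hk Ht.
  assert (Hrev : positive_index (rev ks)) by now apply Forall_rev.
  apply is_derive_ext with
    (fun t => 2 ^ length (ks ++ [S k]) * PSeries (coef (S k :: rev ks)) (tanh (t / 2))).
  { intros s. unfold Ah. rewrite A_PSeries, rev_app_distr. reflexivity. }
  unfold Ah. rewrite A_PSeries, rev_app_distr. cbn [rev app].
  rewrite <- PSeries_derive_coef_S.
  replace (2 ^ length (ks ++ [k]) * _ / _) with
    (2 ^ length (ks ++ [S k]) * ((1 - tanh (t / 2) * tanh (t / 2)) / 2 *
      PSeries (PS_derive (coef (S k :: rev ks))) (tanh (t / 2)))).
  { apply is_derive_scal, PSeries_tanh_half_derive, CV_radius_coef.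
    constructor; [lia|trivial]. }
  rewrite !length_app; cbn [length]. rewrite (sinh_half t).
  set (P := PSeries _ _). set (c := 2 ^ _).
  assert (Hc := cosh_pos (t / 2)).
  assert (Hs : 0 < sinh (t / 2)) by (apply sinh_pos; lra).
  assert (Hcs := cosh2_sinh2 (t / 2)). unfold tanh.
  set (ch := cosh (t / 2)) in *. set (sh := sinh (t / 2)) in *.
  replace (1 - sh / ch * (sh / ch)) with ((ch * ch - sh * sh) / (ch * ch)) by (field; lra).
  rewrite Hcs. field. lra.
Qed.

Lemma Ah_nil t : Ah [] t = 1.
Proof. unfold Ah, A; simpl. rewrite Lim_seq_const. simpl; ring. Qed.

Lemma Ah_at_0 ks : ks <> [] -> Ah ks 0 = 0.
Proof.
  intros Hks. unfold Ah. rewrite A_PSeries.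
  replace (tanh (0 / 2)) with 0.
  2:{ unfold tanh. replace (0 / 2) with 0 by field. rewrite sinh_0. unfold Rdiv; ring. }
  rewrite PSeries_0, coef_0. destruct (rev ks) eqn:E; [|ring].
  apply (f_equal (@rev nat)) in E. rewrite rev_involutive in E. contradiction.
Qed.

Lemma ones_S n : ones (S n) = ones n ++ [1%nat].
Proof. unfold ones. induction n as [|n IH]; [reflexivity|]. simpl in *. now f_equal. Qed.

Lemma Ah_ones n t : Ah (ones n) t = t ^ n / INR (fact n).
Proof.
  revert t; induction n as [|n IH]; intros t.
  - rewrite Ah_nil. simpl. field.
  (* Both sides have the same derivative by induction and vanish at 0, so their difference is
     constant. *)
  - set (g := fun t => Ah (ones (S n)) t - t ^ S n / INR (fact (S n))).
    assert (Hf := INR_fact_neq_0 n).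
    assert (Hg : forall s, is_derive g s 0).
    { intros s. unfold g. rewrite ones_S.
      replace 0 with (Ah (ones n) s - s ^ n / INR (fact n)) by (rewrite IH; ring).
      apply (is_derive_minus (Ah (ones n ++ [1%nat]))
               (fun t => t ^ S n / INR (fact (S n)))); [apply Ah_derive_1, ones_positive|].
      assert (Hn : INR (S n) <> 0) by now apply not_0_INR.
      rewrite fact_simpl, mult_INR. set (m := INR (S n)) in *.
      replace (s ^ n / INR (fact n)) with (m * s ^ n / (m * INR (fact n)))
        by (field; tauto).
      auto_derive; [trivial|]. change (match n with 0%nat => 1 | S _ => INR n + 1 end) with m.
      field. tauto. }
    assert (Hg0 : g 0 = 0).
    { unfold g. rewrite Ah_at_0 by discriminate. simpl. unfold Rdiv; ring. }
    enough (g t = 0) by (unfold g in *; lra).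
    destruct (Rtotal_order t 0) as [H|[H|H]].
    + rewrite <- Hg0. apply (eq_is_derive g); [intros; apply Hg|exact H].
    + now rewrite H.
    + rewrite <- Hg0. symmetry. apply (eq_is_derive g); [intros; apply Hg|exact H].
Qed.

Lemma rev_ones n : rev (ones n) = ones n.
Proof.
  induction n as [|n IH]; [reflexivity|]. rewrite ones_S at 1.
  rewrite rev_app_distr, IH. reflexivity.
Qed.

(** For z >= 0 the series can be compared term by term with that of the index of ones of the same
    length. *)
Lemma Ah_bounds ks t : positive_index ks -> 0 <= t ->
  0 <= Ah ks t <= t ^ length ks / INR (fact (length ks)).
Proof.
  intros Hks Ht. rewrite <- Ah_ones. unfold Ah. rewrite !A_PSeries, rev_ones.
  assert (Hrev : positive_index (rev ks)) by now apply Forall_rev.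
  assert (Hz : 0 <= tanh (t / 2)) by (apply tanh_nonneg; lra).
  assert (Hz1 := tanh_Rabs_lt (t / 2)).
  unfold ones at 1; rewrite repeat_length.
  assert (H2 : 0 < 2 ^ length ks) by (apply pow_lt; lra).
  split.
  - apply Rmult_le_pos; [lra|]. rewrite <- (PSeries_const_0 (tanh (t / 2))).
    apply Series_le; [|now apply ex_series_coef]. intros n.
    rewrite Rmult_0_l. split; [lra|].
    apply Rmult_le_pos; [now apply coef_nonneg|now apply pow_le].
  - apply Rmult_le_compat_l; [lra|]. unfold PSeries.
    apply Series_le; [|apply ex_series_coef; [apply ones_positive|exact Hz1]].
    intros n. rewrite <- (length_rev ks).
    destruct (coef_nested_sum_bounds (rev ks) Hrev) as [Hc _]. specialize (Hc n).
    split.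
    + apply Rmult_le_pos; [apply Hc|now apply pow_le].
    + apply Rmult_le_compat_r; [now apply pow_le|apply Hc].
Qed.

(** * Decay of powers divided by sinh *)

(** The bound has both a simple zero at 0 and exponential growth, so it controls quotients by sinh
    at both ends of the half line. *)
Lemma sinh_lower t : 0 <= t -> t * exp (t / 2) / 4 <= sinh t.
Proof.
  intros Ht. assert (H0 := exp_pos t). assert (H0' := exp_pos (- t)).
  assert (H1 : exp t * exp (- t) = 1) by (rewrite <- exp_plus, Rplus_opp_r; apply exp_0).
  assert (H2 : exp t = exp (t / 2) * exp (t / 2))
    by (rewrite <- exp_plus; f_equal; field).
  assert (Hh := exp_pos (t / 2)).
  assert (H3 := exp_ineq1_le (t / 2)). assert (H4 := exp_ineq1_le t).
  unfold sinh. set (x := exp (- t)) in *. set (y := exp (t / 2)) in *.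
  assert (t * y / 2 <= exp t - x); [|lra].
  (* After multiplication by exp t = y^2 the right side is y^4 - 1 = (y - 1)(y + 1)(y^2 + 1), and y
     - 1 >= t / 2. *)
  apply Rmult_le_reg_l with (exp t); [exact H0|].
  rewrite Rmult_minus_distr_l, H1.
  apply Rle_trans with ((y - 1) * (y + 1) * (exp t + 1)); [|right; rewrite H2; ring].
  apply Rle_trans with (t / 2 * (y + 1) * (exp t + 1)); [nra|].
  apply Rmult_le_compat_r; [lra|]. apply Rmult_le_compat_r; lra.
Qed.

(** One factor t cancels the zero of sinh. Of the growth exp (t / 2), one half pays for t^n <= 4^n
    n! exp (t / 4) and the other half remains as decay. *)
Lemma pow_div_sinh_le n : exists M, forall t, 0 < t ->
  t ^ S n / sinh t <= M * exp (- (t / 4)).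
Proof.
  exists (4 * 4 ^ n * INR (fact n)). intros t Ht.
  assert (Hs := sinh_pos t Ht). assert (Hl := sinh_lower t (Rlt_le _ _ Ht)).
  apply Rmult_le_reg_r with (sinh t); [exact Hs|].
  replace (t ^ S n / sinh t * sinh t) with (t * t ^ n) by (simpl; field; lra).
  assert (Hp : t ^ n <= 4 ^ n * (INR (fact n) * exp (t / 4))).
  { replace (t ^ n) with (4 ^ n * (t / 4) ^ n)
      by (rewrite <- Rpow_mult_distr; f_equal; field).
    apply Rmult_le_compat_l; [apply pow_le; lra|]. apply pow_le_fact_exp; lra. }
  set (c := 4 ^ n) in *. set (f := INR (fact n)) in *.
  assert (Hc : 0 < c) by (apply pow_lt; lra).
  assert (Hf : 0 < f) by apply INR_fact_lt_0.
  assert (He : exp (t / 4) = exp (t / 2) * exp (- (t / 4)))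
    by (rewrite <- exp_plus; f_equal; field).
  assert (H4 := exp_pos (- (t / 4))).
  apply Rle_trans with (t * (c * (f * exp (t / 4)))); [nra|].
  rewrite He.
  replace (t * (c * (f * (exp (t / 2) * exp (- (t / 4)))))) with
    (4 * c * f * exp (- (t / 4)) * (t * exp (t / 2) / 4)) by field.
  apply Rmult_le_compat_l; [|exact Hl].
  repeat apply Rmult_le_pos; lra.
Qed.

(** * Primitives on the open half line and improper integrals *)

(** The limit 0 at 0+ replaces a value at 0, where the integrands are divided by sinh 0 = 0. It
    makes the primitive unique, and the limit of G at infinity becomes the integral over the half
    line. *)
Definition is_primitive (f G : R -> R) : Prop :=
  (forall t, 0 < t -> is_derive G t (f t)) /\ filterlim G (at_right 0) (locally 0).

Lemma at_right_0_pos : at_right 0 (fun t => 0 < t).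
Proof. exists (mkposreal 1 Rlt_0_1). intros y _ Hy. exact Hy. Qed.

Lemma infty_pos : Rbar_locally p_infty (fun t => 0 < t).
Proof. exists 0. easy. Qed.

Lemma filter_prod_pos (P : R -> Prop) : (forall t, 0 < t -> P t) ->
  filter_prod (at_right 0) (Rbar_locally p_infty)
    (fun ab => forall x, Rmin (fst ab) (snd ab) <= x <= Rmax (fst ab) (snd ab) -> P x).
Proof.
  intros HP. apply Filter_prod with (fun t => 0 < t) (fun t => 0 < t).
  - apply at_right_0_pos.
  - apply infty_pos.
  - intros x y Hx Hy t Ht. simpl in Ht. apply HP.
    assert (0 < Rmin x y) by (now apply Rmin_glb_lt). lra.
Qed.

Lemma is_RInt_gen_ext_pos (f g : R -> R) l : (forall t, 0 < t -> f t = g t) ->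
  is_RInt_gen f (at_right 0) (Rbar_locally p_infty) l ->
  is_RInt_gen g (at_right 0) (Rbar_locally p_infty) l.
Proof.
  intros H. apply is_RInt_gen_ext.
  eapply filter_imp; [|exact (filter_prod_pos (fun t => f t = g t) H)].
  intros ab Hab t Ht. apply Hab. lra.
Qed.

Lemma filterlim_plus_R {U} (F : (U -> Prop) -> Prop) {FF : Filter F}
    (f g : U -> R) (a b : R) :
  filterlim f F (locally a) -> filterlim g F (locally b) ->
  filterlim (fun x => f x + g x) F (locally (a + b)).
Proof.
  intros Hf Hg. apply (filterlim_comp_2 f g Rplus Hf Hg).
  apply (@filterlim_plus R_AbsRing R_NormedModule).
Qed.

Lemma filterlim_mult_R {U} (F : (U -> Prop) -> Prop) {FF : Filter F}
    (f g : U -> R) (a b : R) :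
  filterlim f F (locally a) -> filterlim g F (locally b) ->
  filterlim (fun x => f x * g x) F (locally (a * b)).
Proof.
  intros Hf Hg. apply (filterlim_comp_2 f g Rmult Hf Hg).
  apply (@filterlim_mult R_AbsRing).
Qed.

Lemma filterlim_scal_R {U} (F : (U -> Prop) -> Prop) {FF : Filter F}
    (f : U -> R) (c a : R) :
  filterlim f F (locally a) -> filterlim (fun x => c * f x) F (locally (c * a)).
Proof. intros Hf. apply (filterlim_mult_R F); [apply filterlim_const|exact Hf]. Qed.

Lemma filterlim_minus_R {U} (F : (U -> Prop) -> Prop) {FF : Filter F}
    (f g : U -> R) (a b : R) :
  filterlim f F (locally a) -> filterlim g F (locally b) ->
  filterlim (fun x => f x - g x) F (locally (a - b)).
Proof.
  intros Hf Hg. replace (a - b) with (a + -1 * b) by ring.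
  apply filterlim_ext with (fun x => f x + -1 * g x); [intros; ring|].
  apply (filterlim_plus_R F); [exact Hf|]. now apply (filterlim_scal_R F).
Qed.

Lemma primitive_plus f g F G : is_primitive f F -> is_primitive g G ->
  is_primitive (fun t => f t + g t) (fun t => F t + G t).
Proof.
  intros [HF F0] [HG G0]. split.
  - intros t Ht. apply (is_derive_plus F G); auto.
  - replace 0 with (0 + 0) at 2 by ring. now apply (filterlim_plus_R _).
Qed.

Lemma primitive_minus f g F G : is_primitive f F -> is_primitive g G ->
  is_primitive (fun t => f t - g t) (fun t => F t - G t).
Proof.
  intros [HF F0] [HG G0]. split.
  - intros t Ht. apply (is_derive_minus F G); auto.
  - replace 0 with (0 - 0) at 2 by ring. now apply (filterlim_minus_R _).
Qed.

Lemma primitive_increasing f G : (forall t, 0 < t -> is_derive G t (f t)) ->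
  (forall t, 0 < t -> 0 <= f t) -> forall x y, 0 < x <= y -> G x <= G y.
Proof.
  intros HG Hf x y [Hx [Hxy|<-]]; [|lra].
  destruct (MVT_gen G x y f) as [c [Hc E]].
  - intros t Ht. rewrite Rmin_left, Rmax_right in Ht by lra. apply HG; lra.
  - intros t Ht. rewrite Rmin_left, Rmax_right in Ht by lra.
    apply continuity_pt_filterlim, (@ex_derive_continuous R_AbsRing R_NormedModule).
    exists (f t). apply HG; lra.
  - rewrite Rmin_left, Rmax_right in Hc by lra.
    assert (0 <= f c) by (apply Hf; lra). nra.
Qed.

(** This is how integrations by parts are carried out: the primitive obtained by integration must
    agree with the explicit product of functions F, so their limits at infinity agree too. *)
Lemma primitive_unique f G H : is_primitive f G -> is_primitive f H ->
  forall t, 0 < t -> G t = H t.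
Proof.
  intros HG HH t Ht.
  assert (HD := primitive_minus _ _ _ _ HG HH). destruct HD as [HD D0].
  set (D := fun t => G t - H t) in *.
  assert (HD' : forall s, 0 < s -> is_derive D s 0).
  { intros s Hs. replace 0 with (f s - f s) by ring. now apply HD. }
  assert (Hconst : forall s, 0 < s -> D s = D t).
  { intros s Hs. destruct (Rtotal_order s t) as [H1|[->|H1]]; [|reflexivity|].
    - apply (eq_is_derive D); [intros; apply HD'; lra|exact H1].
    - symmetry. apply (eq_is_derive D); [intros; apply HD'; lra|exact H1]. }
  enough (E : D t = 0) by (unfold D in E; lra).
  apply (@filterlim_locally_unique R R_AbsRing R_NormedModule (at_right 0) _ D); [|exact D0].
  apply filterlim_ext_loc with (fun _ => D t); [|apply filterlim_const].
  generalize at_right_0_pos. apply filter_imp. intros s Hs. symmetry. now apply Hconst.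
Qed.

Lemma primitive_is_RInt_gen f G l : is_primitive f G ->
  (forall t, 0 < t -> continuous f t) ->
  filterlim G (Rbar_locally p_infty) (locally l) ->
  is_RInt_gen f (at_right 0) (Rbar_locally p_infty) l.
Proof.
  intros [HG G0] Hf Hl.
  assert (HD : forall t, 0 < t -> Derive G t = f t).
  { intros t Ht. apply is_derive_unique. now apply HG. }
  replace l with (l - 0) by ring.
  apply (is_RInt_gen_ext_pos (Derive G)); [exact HD|].
  apply is_RInt_gen_Derive; [| |exact G0|exact Hl].
    + apply (filter_prod_pos (fun t => ex_derive G t)). intros t Ht. exists (f t). now apply HG.
    + apply (filter_prod_pos (fun t => continuous (Derive G) t)). intros t Ht.
      apply continuous_ext_loc with f; [|now apply Hf].
      exists (mkposreal t Ht). intros y Hy. symmetry. apply HD.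
      apply Rabs_def2 in Hy. unfold minus, plus, opp in Hy; simpl in Hy. lra.
Qed.

(** The limit is the supremum, hence also an upper bound for all values; this second fact is used
    later to bound truncated sums. *)
Lemma increasing_lim_infty g B :
  (forall x y, 0 < x <= y -> g x <= g y) -> (forall x, 0 < x -> g x <= B) ->
  exists l, filterlim g (Rbar_locally p_infty) (locally l) /\
    forall x, 0 < x -> g x <= l.
Proof.
  intros Hg HB.
  destruct (completeness (fun y => exists x, 0 < x /\ y = g x)) as [l [Hub Hlub]].
  - exists B. intros y [x [Hx ->]]. now apply HB.
  - exists (g 1), 1. split; [lra|reflexivity].
  - exists l. assert (Hl : forall x, 0 < x -> g x <= l) by (intros x Hx; apply Hub; eauto).
    split; [|exact Hl].
    apply filterlim_locally. intros [e He].
    destruct (classic (exists x, 0 < x /\ l - e < g x)) as [[x [Hx Hxl]]|Hn].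
    + exists x. intros y Hy. assert (g x <= g y) by (apply Hg; lra).
      assert (g y <= l) by (apply Hl; lra).
      apply Rabs_def1; unfold minus, plus, opp; simpl; lra.
    + exfalso. assert (l <= l - e); [|lra].
      apply Hlub. intros y [x [Hx ->]]. apply Rnot_lt_le. intros H.
      apply Hn. now exists x.
Qed.

(** Since f >= 0, the integral from 1 to t is increasing, and the exponential majorant bounds it on
    both sides; monotone limits then exist at both ends. *)
Lemma primitive_dominated f M :
  (forall t, 0 < t -> continuous f t) ->
  (forall t, 0 < t -> 0 <= f t <= M * exp (- (t / 4))) ->
  exists G l, is_primitive f G /\ filterlim G (Rbar_locally p_infty) (locally l) /\
    forall t, 0 < t -> 0 <= G t <= l.
Proof.
  intros Hc Hf. set (G := fun x => RInt f 1 x).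
  assert (HI : forall x y, 0 < x -> 0 < y -> ex_RInt f x y).
  { intros x y Hx Hy. apply (ex_RInt_continuous (V := R_CompleteNormedModule)).
    intros z Hz. apply Hc. assert (0 < Rmin x y) by (now apply Rmin_glb_lt). lra. }
  assert (HG : forall t, 0 < t -> is_derive G t (f t)).
  { intros t Ht. apply is_derive_RInt with (a := 1); [|now apply Hc].
    exists (mkposreal t Ht). intros y Hy. apply RInt_correct, HI; [lra|].
    apply Rabs_def2 in Hy. unfold minus, plus, opp in Hy; simpl in Hy. lra. }
  assert (Hinc := primitive_increasing f G HG (fun t Ht => proj1 (Hf t Ht))).
  (* [E] is a primitive of M exp (- t / 4) - f >= 0, so its monotonicity bounds the variation of [G]
     by 4 M. *)
  set (E := fun t => - (4 * M) * exp (- (t / 4)) - G t).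
  assert (HE : forall x y, 0 < x <= y -> E x <= E y).
  { apply (primitive_increasing (fun t => M * exp (- (t / 4)) - f t)).
    - intros t Ht. apply (is_derive_minus (fun t => - (4 * M) * exp (- (t / 4))) G);
        [|now apply HG].
      auto_derive; [trivial|]. unfold Rdiv. field.
    - intros t Ht. specialize (Hf t Ht). lra. }
  assert (HM : 0 <= M).
  { assert (H := Hf 1 Rlt_0_1). assert (H1 := exp_pos (- (1 / 4))). nra. }
  assert (He : forall t, 0 < t -> 0 < exp (- (t / 4)) <= 1).
  { intros t Ht. split; [apply exp_pos|]. rewrite <- exp_0.
    apply Rlt_le, exp_increasing. lra. }
  assert (HG1 : G 1 = 0) by exact (RInt_point 1 f).
  assert (Hup : forall t, 0 < t -> G t <= 4 * M).
  { intros t Ht. destruct (Rle_lt_dec t 1) as [H1|H1].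
    - assert (G t <= G 1) by (apply Hinc; lra). nra.
    - assert (H : E 1 <= E t) by (apply HE; lra). unfold E in H. rewrite HG1 in H.
      assert (H2 := He t Ht). assert (H3 := He 1 Rlt_0_1). nra. }
  assert (Hlow : forall t, 0 < t -> - G t <= 4 * M).
  { intros t Ht. destruct (Rle_lt_dec t 1) as [H1|H1].
    - assert (H : E t <= E 1) by (apply HE; lra). unfold E in H. rewrite HG1 in H.
      assert (H2 := He t Ht). assert (H3 := He 1 Rlt_0_1). nra.
    - assert (G 1 <= G t) by (apply Hinc; lra). nra. }
  destruct (increasing_lim_infty G (4 * M) Hinc Hup) as [l [Hl Hle]].
  (* The limit at 0+ is turned into a limit at infinity by x -> 1 / x; the sign restores
     monotonicity. Adding [m] to [G] afterwards makes the limit at 0+ equal to 0. *)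
  destruct (increasing_lim_infty (fun x => - G (/ x)) (4 * M)) as [m [Hm Hme]].
  { intros x y Hxy. apply Ropp_le_contravar, Hinc.
    split; [apply Rinv_0_lt_compat; lra|]. apply Rinv_le_contravar; lra. }
  { intros x Hx. now apply Hlow, Rinv_0_lt_compat. }
  assert (Hinv : forall t, 0 < t -> - G t <= m).
  { intros t Ht. rewrite <- (Rinv_inv t). now apply Hme, Rinv_0_lt_compat. }
  assert (G0 : filterlim G (at_right 0) (locally (- m))).
  { apply filterlim_ext with (fun x => -1 * - G (/ / x)).
    { intros x. rewrite Rinv_inv. ring. }
    replace (- m) with (-1 * m) by ring. apply (filterlim_scal_R _).
    apply (filterlim_comp _ _ _ Rinv (fun x => - G (/ x)) _ (Rbar_locally p_infty));
      [|exact Hm].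
    apply filterlim_Rinv_0_right. }
  exists (fun t => G t + m), (l + m). split; [split|split].
  - intros t Ht. replace (f t) with (f t + 0) by ring.
    apply (is_derive_plus G (fun _ => m)); [now apply HG|]. apply @is_derive_const.
  - replace 0 with (- m + m) at 2 by ring.
    apply (filterlim_plus_R _); [exact G0|apply filterlim_const].
  - apply (filterlim_plus_R _); [exact Hl|apply filterlim_const].
  - intros t Ht. specialize (Hinv t Ht); specialize (Hle t Ht). lra.
Qed.

(** * The pairing J of two indices *)

Lemma Ah_continuous ks t : positive_index ks -> continuous (Ah ks) t.
Proof.
  intros Hks. apply (@ex_derive_continuous R_AbsRing R_NormedModule).
  eexists. apply is_derive_ext with
    (fun t => 2 ^ length ks * PSeries (coef (rev ks)) (tanh (t / 2))).
  { intros s. unfold Ah. now rewrite A_PSeries. }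
  apply is_derive_scal, PSeries_tanh_half_derive, CV_radius_coef. now apply Forall_rev.
Qed.

Lemma Ah_lim_0 ks : positive_index ks -> ks <> [] ->
  filterlim (Ah ks) (at_right 0) (locally 0).
Proof.
  intros Hks Hne. apply (filterlim_filter_le_1 (F := locally 0) (G := at_right 0) (Ah ks));
    [apply filter_le_within|].
  rewrite <- (Ah_at_0 ks Hne) at 2. now apply Ah_continuous.
Qed.

Lemma Ah_div_sinh_continuous a b t : positive_index a -> positive_index b -> 0 < t ->
  continuous (fun t => Ah a t * Ah b t / sinh t) t.
Proof.
  intros Ha Hb Ht. assert (Hs := sinh_pos t Ht).
  apply (continuous_mult (K := R_AbsRing) (fun t => Ah a t * Ah b t) (fun t => / sinh t)).
  - apply (continuous_mult (K := R_AbsRing) (Ah a) (Ah b)); now apply Ah_continuous.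
  - apply continuous_Rinv_comp; [|lra].
    apply (@ex_derive_continuous R_AbsRing R_NormedModule).
    unfold sinh. auto_derive. trivial.
Qed.

(** One symmetric pairing has both psi terms among its values; integrations by parts become linear
    relations between such values. *)
Definition J (a b : list nat) : R :=
  RInt_gen (fun t => Ah a t * Ah b t / sinh t) (at_right 0) (Rbar_locally p_infty).

Lemma pow_div_fact_le t n : 0 <= t -> t ^ n / INR (fact n) <= t ^ n.
Proof.
  intros Ht. assert (H : 1 <= INR (fact n)) by exact (le_INR 1 _ (lt_O_fact n)).
  assert (Hp := pow_le t n Ht). rewrite <- (Rmult_1_r (t ^ n)) at 2.
  apply Rmult_le_compat_l; [exact Hp|].
  rewrite <- Rinv_1. apply Rinv_le_contravar; lra.
Qed.

(** The integrand is at most t^(length a + length b) / sinh t. With [a] nonempty this exponent is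
    positive, which compensates the zero of sinh; [b] may be empty. *)
Lemma J_spec a b : positive_index a -> positive_index b -> a <> [] ->
  exists G, is_primitive (fun t => Ah a t * Ah b t / sinh t) G /\
    filterlim G (Rbar_locally p_infty) (locally (J a b)) /\
    (forall t, 0 < t -> G t <= J a b) /\
    is_RInt_gen (fun t => Ah a t * Ah b t / sinh t)
      (at_right 0) (Rbar_locally p_infty) (J a b).
Proof.
  intros Ha Hb Hne.
  assert (Hlen : exists n, (length a + length b)%nat = S n).
  { destruct a; [contradiction|]. simpl. eauto. }
  destruct Hlen as [n Hn]. destruct (pow_div_sinh_le n) as [M HM].
  assert (Hc := fun t => Ah_div_sinh_continuous a b t Ha Hb).
  destruct (primitive_dominated (fun t => Ah a t * Ah b t / sinh t) M Hc)
    as [G [l [HG [Hl Hle]]]].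
  { intros t Ht. assert (Hs := sinh_pos t Ht).
    assert (H0 : 0 <= t) by lra.
    assert (Hab := Ah_bounds a t Ha H0). assert (Hbb := Ah_bounds b t Hb H0).
    assert (Hpa := pow_div_fact_le t (length a) H0).
    assert (Hpb := pow_div_fact_le t (length b) H0).
    split.
    - apply Rle_mult_inv_pos; [|exact Hs]. apply Rmult_le_pos; lra.
    - eapply Rle_trans; [|now apply HM]. rewrite <- Hn, pow_add.
      apply Rmult_le_compat_r; [now apply Rlt_le, Rinv_0_lt_compat|].
      apply Rmult_le_compat; lra. }
  assert (HI := primitive_is_RInt_gen _ G l HG Hc Hl).
  assert (E : J a b = l) by now apply is_RInt_gen_unique.
  rewrite E. exists G. split; [exact HG|]. split; [exact Hl|]. split; [|exact HI].
  intros t Ht. now apply Hle.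
Qed.

Lemma J_sym a b : positive_index a -> positive_index b -> a <> [] -> J a b = J b a.
Proof.
  intros Ha Hb Hne. symmetry. apply is_RInt_gen_unique.
  destruct (J_spec a b Ha Hb Hne) as [G [_ [_ [_ H]]]].
  apply (is_RInt_gen_ext_pos (fun t => Ah a t * Ah b t / sinh t)); [|exact H].
  intros t _.
  now rewrite (Rmult_comm (Ah b t)).
Qed.

(** * The limit x -> 1- as t -> oo, and the boundary values T *)

Definition two_artanh (x : R) : R := ln ((1 + x) / (1 - x)).

Lemma two_artanh_pos x : 0 < x < 1 -> 0 < two_artanh x.
Proof.
  intros Hx. unfold two_artanh. rewrite <- ln_1. apply ln_increasing; [lra|].
  apply Rmult_lt_reg_r with (1 - x); [lra|]. unfold Rdiv.
  rewrite Rmult_assoc, Rinv_l by lra. lra.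
Qed.

Lemma tanh_two_artanh x : 0 < x < 1 -> tanh (two_artanh x / 2) = x.
Proof.
  intros Hx. unfold tanh, sinh, cosh.
  set (y := exp (two_artanh x / 2)). rewrite exp_Ropp. fold y.
  assert (Hy : 0 < y) by apply exp_pos.
  assert (Hyy : y * y = (1 + x) / (1 - x)).
  { unfold y. rewrite <- exp_plus.
    replace (two_artanh x / 2 + two_artanh x / 2) with (two_artanh x) by field.
    apply exp_ln. apply Rdiv_lt_0_compat; lra. }
  replace ((y - / y) / 2 / ((y + / y) / 2)) with ((y * y - 1) / (y * y + 1)).
  - rewrite Hyy. field. lra.
  - field. nra.
Qed.

Lemma at_left_1_01 : at_left 1 (fun x => 0 < x < 1).
Proof.
  exists (mkposreal 1 Rlt_0_1). intros y Hy H1.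
  apply Rabs_def2 in Hy. unfold minus, plus, opp in Hy; simpl in Hy. lra.
Qed.

Lemma two_artanh_lim : filterlim two_artanh (at_left 1) (Rbar_locally p_infty).
Proof.
  intros P [M HM]. assert (He := exp_pos (- M)).
  assert (H : at_left 1 (fun x => 1 - x < exp (- M))).
  { exists (mkposreal _ He). intros y Hy H1.
    apply Rabs_def2 in Hy. unfold minus, plus, opp in Hy; simpl in Hy. lra. }
  refine (filter_imp _ _ _ (filter_and _ _ at_left_1_01 H)).
  intros x [Hx Hx']. apply HM. unfold two_artanh.
  rewrite <- (ln_exp M). apply ln_increasing; [apply exp_pos|].
  apply Rmult_lt_reg_r with (1 - x); [lra|].
  unfold Rdiv. rewrite Rmult_assoc, Rinv_l by lra.
  apply Rlt_le_trans with (exp M * exp (- M)).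
  - apply Rmult_lt_compat_l; [apply exp_pos|exact Hx'].
  - rewrite <- exp_plus, Rplus_opp_r, exp_0. lra.
Qed.

(** For n <= N one has x^N <= x^n. Letting x tend to 1 turns a bound for the power series into one
    for the truncated sum. *)
Lemma nested_sum_le_PSeries l N x : positive_index l -> 0 <= x < 1 ->
  nested_sum l (fun _ => 1) N * x ^ N <= PSeries (coef l) x.
Proof.
  intros Hl Hx.
  assert (Hpos : forall n, 0 <= coef l n * x ^ n).
  { intros n. apply Rmult_le_pos; [now apply coef_nonneg|apply pow_le; lra]. }
  apply Rle_trans with (sum_n (fun n => coef l n * x ^ n) N).
  - induction N as [|N IH].
    + rewrite sum_O, nested_sum_1_0. lra.
    + rewrite sum_Sn, nested_sum_1_S. unfold plus; simpl.
      assert (0 <= nested_sum l (fun _ => 1) N * x ^ N)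
        by (apply Rmult_le_pos; [now apply nested_sum_nonneg|apply pow_le; lra]).
      nra.
  - apply (is_lim_seq_incr_compare (sum_n (fun n => coef l n * x ^ n))).
    + apply Series_correct, ex_series_coef; [exact Hl|]. apply Rabs_def1; lra.
    + intros n. rewrite sum_Sn. unfold plus; simpl. specialize (Hpos (S n)).
      simpl in Hpos. lra.
Qed.

Lemma PSeries_le_bound l s x : positive_index l -> 0 <= x < 1 ->
  (forall N, nested_sum l (fun _ => 1) N <= s) -> PSeries (coef l) x <= s.
Proof.
  intros Hl Hx Hs.
  apply (is_lim_seq_le (sum_n (fun n => coef l n * x ^ n)) (fun _ => s)
           (PSeries (coef l) x) s).
  - intros n. eapply Rle_trans; [|apply (Hs n)].
    rewrite nested_sum_coef by reflexivity. apply sum_n_m_le. intros m.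
    apply Rmult_le_compat_l; [now apply coef_nonneg|].
    rewrite <- (pow1 m). apply pow_incr. lra.
  - apply Series_correct, ex_series_coef; [exact Hl|]. apply Rabs_def1; lra.
  - apply is_lim_seq_const.
Qed.

Lemma le_of_mul_pow_le c B N :
  (forall x, 0 < x < 1 -> c * x ^ N <= B) -> c <= B.
Proof.
  intros H.
  apply (filterlim_le (F := at_left 1) (fun x => c * x ^ N) (fun _ => B) c B).
  - generalize at_left_1_01. apply filter_imp. exact H.
  - apply (filterlim_filter_le_1 (F := locally 1) (G := at_left 1) (fun x => c * x ^ N));
      [apply filter_le_within|].
    assert (Hc : continuous (fun x => c * x ^ N) 1).
    { apply (@ex_derive_continuous R_AbsRing R_NormedModule). auto_derive. trivial. }
    unfold continuous in Hc. rewrite pow1, Rmult_1_r in Hc. exact Hc.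
  - apply filterlim_const.
Qed.

Lemma positive_index_app a b :
  positive_index a -> positive_index b -> positive_index (a ++ b).
Proof. intros Ha Hb. apply Forall_app. now split. Qed.

Lemma positive_index_1 k : (1 <= k)%nat -> positive_index [k].
Proof. intros H; now constructor. Qed.

(* Abel's theorem for the nonnegative coefficients of A; finiteness of T comes
   from the integrability of A(..., k) / sinh. *)
Lemma Ah_lim_T ks k : positive_index ks -> (1 <= k)%nat ->
  filterlim (Ah (ks ++ [S k])) (Rbar_locally p_infty) (locally (T (ks ++ [S k]))).
Proof.
  intros Hks Hk.
  assert (Hka : positive_index (ks ++ [k]))
    by now apply positive_index_app, positive_index_1.
  assert (HkS : positive_index (ks ++ [S k]))
    by (apply positive_index_app, positive_index_1; [trivial|lia]).
  assert (Hne : ks ++ [k] <> []) by (now destruct ks).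
  assert (HneS : ks ++ [S k] <> []) by (now destruct ks).
  (* Pairing with the empty index, where F = 1, gives the integral of F_(ks,k) / sinh, whose
     primitive is F_(ks,k+1). *)
  destruct (J_spec (ks ++ [k]) [] Hka (Forall_nil _) Hne) as [G [HG [Hl [Hle _]]]].
  set (B := J _ _) in *.
  assert (HA : is_primitive (fun t => Ah (ks ++ [k]) t * Ah [] t / sinh t) (Ah (ks ++ [S k]))).
  { split; [|now apply Ah_lim_0]. intros t Ht. rewrite Ah_nil, Rmult_1_r.
    now apply Ah_derive_S. }
  assert (E := primitive_unique _ _ _ HG HA).
  assert (HlA : filterlim (Ah (ks ++ [S k])) (Rbar_locally p_infty) (locally B)).
  { apply filterlim_ext_loc with G; [|exact Hl].
    generalize infty_pos. apply filter_imp. exact E. }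
  (* The limit exists and is [B]. For T = B, the truncated sums are at most B / c because F <= B,
     and conversely F is at most c times their limit. *)
  enough (HT : T (ks ++ [S k]) = B) by now rewrite HT.
  set (l := rev (ks ++ [S k])).
  assert (Hrev : positive_index l) by now apply Forall_rev.
  set (c := 2 ^ length (ks ++ [S k])). assert (Hc : 0 < c) by (apply pow_lt; lra).
  assert (HcB : forall N, nested_sum l (fun _ => 1) N <= B / c).
  { intros N. apply le_of_mul_pow_le with N. intros x Hx.
    apply Rle_trans with (PSeries (coef l) x); [apply nested_sum_le_PSeries; trivial; lra|].
    apply Rmult_le_reg_l with c; [exact Hc|].
    replace (c * (B / c)) with B by (field; lra).
    assert (Hp := two_artanh_pos x Hx). specialize (Hle _ Hp). rewrite (E _ Hp) in Hle.
    unfold Ah in Hle. rewrite tanh_two_artanh, A_PSeries in Hle by exact Hx. exact Hle. }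
  destruct (ex_finite_lim_seq_incr (nested_sum l (fun _ => 1)) (B / c)) as [s Hs].
  { intros n. rewrite nested_sum_1_S. assert (H := coef_nonneg l (S n) Hrev). lra. }
  { exact HcB. }
  unfold T. fold l c. rewrite (is_lim_seq_unique _ _ Hs). simpl.
  assert (HsB : s <= B / c).
  { apply (is_lim_seq_le _ _ s (B / c) HcB Hs (is_lim_seq_const _)). }
  assert (HBs : B <= c * s).
  { apply (filterlim_le (F := Rbar_locally p_infty) (Ah (ks ++ [S k]))
             (fun _ => c * s) B (c * s)); [|exact HlA|apply filterlim_const].
    generalize infty_pos. apply filter_imp. intros t Ht.
    unfold Ah. rewrite A_PSeries. fold l c. apply Rmult_le_compat_l; [lra|].
    apply PSeries_le_bound; [exact Hrev| |].
    - split; [apply tanh_nonneg; lra|].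
      assert (H := tanh_Rabs_lt (t / 2)). apply Rabs_def2 in H. lra.
    - apply (is_lim_seq_incr_compare (nested_sum l (fun _ => 1)) s Hs).
      intros n. rewrite nested_sum_1_S. assert (H := coef_nonneg l (S n) Hrev). lra. }
  apply Rle_antisym; [|exact HBs].
  apply Rmult_le_reg_r with (/ c); [now apply Rinv_0_lt_compat|].
  replace (c * s * / c) with s by (field; lra). exact HsB.
Qed.

(** * The two integrations by parts *)

(** Product rule for F_(a,i+1) F_(b,m+1): it vanishes at 0+, and at infinity both factors converge
    to values of T since both last entries are at least 2. *)
Lemma J_by_parts a b i m : positive_index a -> positive_index b ->
  (1 <= i)%nat -> (1 <= m)%nat ->
  J (a ++ [i]) (b ++ [S m]) + J (a ++ [S i]) (b ++ [m])
  = T (a ++ [S i]) * T (b ++ [S m]).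
Proof.
  intros Ha Hb Hi Hm.
  assert (Hp : forall c j, positive_index c -> (1 <= j)%nat -> positive_index (c ++ [j]))
    by (intros c j Hc Hj; now apply positive_index_app, positive_index_1).
  assert (Hne : forall (c : list nat) j, c ++ [j] <> []) by (intros c j; now destruct c).
  destruct (J_spec (a ++ [i]) (b ++ [S m])) as [G1 [HG1 [Hl1 _]]]; auto.
  destruct (J_spec (a ++ [S i]) (b ++ [m])) as [G2 [HG2 [Hl2 _]]]; auto.
  set (P := fun t => Ah (a ++ [S i]) t * Ah (b ++ [S m]) t).
  assert (HP : is_primitive (fun t => Ah (a ++ [i]) t * Ah (b ++ [S m]) t / sinh t +
                 Ah (a ++ [S i]) t * Ah (b ++ [m]) t / sinh t) P).
  { split.
    - intros t Ht. assert (Hs := sinh_pos t Ht).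
      replace (Ah (a ++ [i]) t * Ah (b ++ [S m]) t / sinh t +
               Ah (a ++ [S i]) t * Ah (b ++ [m]) t / sinh t)
        with (Ah (a ++ [i]) t / sinh t * Ah (b ++ [S m]) t +
              Ah (a ++ [S i]) t * (Ah (b ++ [m]) t / sinh t)) by (field; lra).
      apply (is_derive_mult (K := R_AbsRing) (Ah (a ++ [S i])) (Ah (b ++ [S m])));
        [now apply Ah_derive_S|now apply Ah_derive_S|apply Rmult_comm].
    - replace 0 with (0 * 0) at 2 by ring.
      apply (filterlim_mult_R _); apply Ah_lim_0; auto. }
  assert (E := primitive_unique _ _ _ (primitive_plus _ _ _ _ HG1 HG2) HP).
  apply (filterlim_locally_unique (V := R_NormedModule) (F := Rbar_locally p_infty) P).
  - apply filterlim_ext_loc with (fun t => G1 t + G2 t).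
    + generalize infty_pos. apply filter_imp. exact E.
    + now apply (filterlim_plus_R _).
  - apply (filterlim_mult_R _); now apply Ah_lim_T.
Qed.

(** Differentiating either product yields the term F_(a,i+1) F_(b,m+1), which is not integrable at
    infinity. It cancels in the derivative, before any integral is taken, and two convergent
    integrals remain. *)
Lemma J_bracket a b i m : positive_index a -> positive_index b ->
  (1 <= i)%nat -> (1 <= m)%nat ->
  filterlim (fun t => Ah (a ++ [S i]) t * Ah ((b ++ [S m]) ++ [1%nat]) t
                    - Ah ((a ++ [S i]) ++ [1%nat]) t * Ah (b ++ [S m]) t)
    (Rbar_locally p_infty)
    (locally (J (a ++ [i]) ((b ++ [S m]) ++ [1%nat])
              - J ((a ++ [S i]) ++ [1%nat]) (b ++ [m]))).
Proof.
  intros Ha Hb Hi Hm.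
  assert (Hp : forall c j, positive_index c -> (1 <= j)%nat -> positive_index (c ++ [j]))
    by (intros c j Hc Hj; now apply positive_index_app, positive_index_1).
  assert (Hne : forall (c : list nat) j, c ++ [j] <> []) by (intros c j; now destruct c).
  destruct (J_spec (a ++ [i]) ((b ++ [S m]) ++ [1%nat])) as [G1 [HG1 [Hl1 _]]]; auto.
  destruct (J_spec ((a ++ [S i]) ++ [1%nat]) (b ++ [m])) as [G2 [HG2 [Hl2 _]]]; auto.
  set (P := fun t => Ah (a ++ [S i]) t * Ah ((b ++ [S m]) ++ [1%nat]) t
                    - Ah ((a ++ [S i]) ++ [1%nat]) t * Ah (b ++ [S m]) t).
  assert (HP : is_primitive (fun t => Ah (a ++ [i]) t * Ah ((b ++ [S m]) ++ [1%nat]) t / sinh t -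
                 Ah ((a ++ [S i]) ++ [1%nat]) t * Ah (b ++ [m]) t / sinh t) P).
  { split.
    - intros t Ht. assert (Hs := sinh_pos t Ht).
      replace (Ah (a ++ [i]) t * Ah ((b ++ [S m]) ++ [1%nat]) t / sinh t -
               Ah ((a ++ [S i]) ++ [1%nat]) t * Ah (b ++ [m]) t / sinh t)
        with ((Ah (a ++ [i]) t / sinh t * Ah ((b ++ [S m]) ++ [1%nat]) t +
               Ah (a ++ [S i]) t * Ah (b ++ [S m]) t) -
              (Ah (a ++ [S i]) t * Ah (b ++ [S m]) t +
               Ah ((a ++ [S i]) ++ [1%nat]) t * (Ah (b ++ [m]) t / sinh t)))
        by (field; lra).
      apply (is_derive_minus (K := R_AbsRing) (V := R_NormedModule)
        (fun t => Ah (a ++ [S i]) t * Ah ((b ++ [S m]) ++ [1%nat]) t)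
        (fun t => Ah ((a ++ [S i]) ++ [1%nat]) t * Ah (b ++ [S m]) t)).
      + apply (is_derive_mult (K := R_AbsRing) (Ah (a ++ [S i])) (Ah ((b ++ [S m]) ++ [1%nat])));
          [now apply Ah_derive_S|apply Ah_derive_1; auto|apply Rmult_comm].
      + apply (is_derive_mult (K := R_AbsRing) (Ah ((a ++ [S i]) ++ [1%nat])) (Ah (b ++ [S m])));
          [apply Ah_derive_1; auto|now apply Ah_derive_S|apply Rmult_comm].
    - replace 0 with (0 * 0 - 0 * 0) at 2 by ring.
      apply (filterlim_minus_R _); apply (filterlim_mult_R _); apply Ah_lim_0; auto. }
  assert (E := primitive_unique _ _ _ (primitive_minus _ _ _ _ HG1 HG2) HP).
  apply filterlim_ext_loc with (fun t => G1 t - G2 t).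
  - generalize infty_pos. apply filter_imp. exact E.
  - now apply (filterlim_minus_R _).
Qed.

(** * Gamma at integers, and psi as a value of J *)

(** The functional equation of Gamma at the level of primitives: the one for n + 1 is (n + 1) times
    the one for n, minus t^(n+1) exp (- t). *)
Lemma Gamma_primitive n : exists G, is_primitive (fun t => t ^ n * exp (- t)) G /\
  filterlim G (Rbar_locally p_infty) (locally (INR (fact n))).
Proof.
  assert (Hdecay : forall m, filterlim (fun t => t ^ m * exp (- t))
                     (Rbar_locally p_infty) (locally 0)).
  { intros m. apply filterlim_locally. intros [e He].
    set (f := INR (fact (S m))). assert (Hf : 0 < f) by apply INR_fact_lt_0.
    (* Since t^(m+1) exp (- t) <= (m + 1)! = f, the quantity t^m exp (- t) is at most f / t, which
       is below e beyond f / e. *)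
    exists (f / e). intros t Ht.
    assert (H0 : 0 < t) by (eapply Rlt_trans; [|exact Ht]; now apply Rdiv_lt_0_compat).
    assert (H := pow_le_fact_exp (S m) t (Rlt_le _ _ H0)). fold f in H. simpl in H.
    assert (Hx := exp_pos (- t)).
    assert (H1 : exp t * exp (- t) = 1) by (rewrite <- exp_plus, Rplus_opp_r; apply exp_0).
    assert (Hm : 0 <= t ^ m * exp (- t)) by (apply Rmult_le_pos; [apply pow_le|]; lra).
    assert (H2 : t * (t ^ m * exp (- t)) <= f).
    { replace f with (f * exp t * exp (- t)) by (rewrite Rmult_assoc, H1; ring).
      rewrite <- Rmult_assoc. apply Rmult_le_compat_r; lra. }
    assert (H3 : f < t * e).
    { apply (Rmult_lt_compat_r e) in Ht; [|exact He].
      replace (f / e * e) with f in Ht by (field; lra). exact Ht. }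
    assert (H4 : t ^ m * exp (- t) < e) by (apply Rmult_lt_reg_l with t; lra).
    apply Rabs_def1; unfold minus, plus, opp; simpl; lra. }
  assert (Hcont : forall m, filterlim (fun t => t ^ m * exp (- t)) (at_right 0)
                    (locally (0 ^ m))).
  { intros m. apply (filterlim_filter_le_1 (F := locally 0) (G := at_right 0)
                       (fun t => t ^ m * exp (- t))); [apply filter_le_within|].
    assert (Hc : continuous (fun t => t ^ m * exp (- t)) 0).
    { apply (@ex_derive_continuous R_AbsRing R_NormedModule). auto_derive. trivial. }
    unfold continuous in Hc. rewrite Ropp_0, exp_0, Rmult_1_r in Hc. exact Hc. }
  induction n as [|n [G [[HG G0] Hl]]].
  - exists (fun t => 1 - t ^ 0 * exp (- t)). split; [split|].
    + intros t _. auto_derive; [trivial|]. simpl. ring.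
    + replace 0 with (1 - 0 ^ 0) at 2 by (simpl; ring).
      apply (filterlim_minus_R _); [apply filterlim_const|apply Hcont].
    + replace (INR (fact 0)) with (1 - 0) by (simpl; ring).
      apply (filterlim_minus_R _); [apply filterlim_const|apply Hdecay].
  - exists (fun t => INR (S n) * G t - t ^ S n * exp (- t)). split; [split|].
    + intros t Ht.
      replace (t ^ S n * exp (- t)) with
        (INR (S n) * (t ^ n * exp (- t)) -
         (INR (S n) * t ^ n * exp (- t) - t ^ S n * exp (- t))) by ring.
      apply (is_derive_minus (K := R_AbsRing) (V := R_NormedModule)
               (fun t => INR (S n) * G t) (fun t => t ^ S n * exp (- t))).
      * apply is_derive_scal. now apply HG.
      * set (m := INR (S n)). auto_derive; [trivial|].
        change (match n with 0%nat => 1 | S _ => INR n + 1 end) with m. simpl. ring.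
    + replace 0 with (INR (S n) * 0 - 0 ^ S n) at 2 by (simpl; ring).
      apply (filterlim_minus_R _); [now apply (filterlim_scal_R _)|apply Hcont].
    + rewrite fact_simpl, mult_INR.
      replace (INR (S n) * INR (fact n)) with (INR (S n) * INR (fact n) - 0) by ring.
      apply (filterlim_minus_R _); [now apply (filterlim_scal_R _)|apply Hdecay].
Qed.

Lemma Rpower_INR_succ n t : 0 < t -> Rpower t (INR n + 1 - 1) = t ^ n.
Proof.
  intros Ht. replace (INR n + 1 - 1) with (INR n) by ring. now apply Rpower_pow.
Qed.

Lemma Gamma_fact n : Gamma (INR n + 1) = INR (fact n).
Proof.
  destruct (Gamma_primitive n) as [G [HG Hl]].
  apply is_RInt_gen_unique. apply (is_RInt_gen_ext_pos (fun t => t ^ n * exp (- t))).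
  - intros t Ht. now rewrite Rpower_INR_succ.
  - apply primitive_is_RInt_gen with G; [exact HG| |exact Hl].
    intros t _. apply (@ex_derive_continuous R_AbsRing R_NormedModule).
    auto_derive. trivial.
Qed.

Lemma psi_J ks n : positive_index ks -> (1 <= n)%nat ->
  psi ks (INR n + 1) = J (ones n) ks.
Proof.
  intros Hks Hn. unfold psi. rewrite Gamma_fact.
  assert (Hf := INR_fact_neq_0 n).
  assert (Hne : ones n <> []) by (destruct n; [lia|discriminate]).
  destruct (J_spec (ones n) ks (ones_positive n) Hks Hne) as [_ [_ [_ [_ HI]]]].
  rewrite (is_RInt_gen_unique _ (INR (fact n) * J (ones n) ks)); [field; exact Hf|].
  refine (is_RInt_gen_ext_pos _ _ _ _ (is_RInt_gen_scal _ (INR (fact n)) _ HI)).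
  intros t Ht. rewrite Rpower_INR_succ, Ah_ones by exact Ht.
  assert (Hs := sinh_pos t Ht). unfold scal; simpl. unfold mult; simpl. unfold Ah.
  field. lra.
Qed.

(** * Assembling the sums, signs and indices *)

Lemma sum_list_ext l f g : (forall i, In i l -> f i = g i) -> sum_list l f = sum_list l g.
Proof. intros H. unfold sum_list. f_equal. now apply map_ext_in. Qed.

Lemma sum_list_seq_S m n f :
  sum_list (seq m (S n)) f = sum_list (seq m n) f + f (m + n)%nat.
Proof. rewrite seq_S, sum_list_app. unfold sum_list at 2; simpl. ring. Qed.

(** Each use of [J_by_parts] moves one unit from the last entry of the second index to that of the
    first and flips the sign. After k - 2 moves the entries 1 and k - 1 are exchanged, and
    (-1)^(k-2) = (-1)^k. *)
Lemma J_chain a b k : positive_index a -> positive_index b -> (2 <= k)%nat ->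
  J (a ++ [1%nat]) (b ++ [(k - 1)%nat]) =
  sum_list (seq 1 (k - 2)) (fun i =>
    (-1) ^ (i - 1) * T (a ++ [(i + 1)%nat]) * T (b ++ [(k - i)%nat]))
  + (-1) ^ k * J (a ++ [(k - 1)%nat]) (b ++ [1%nat]).
Proof.
  intros Ha Hb Hk.
  assert (H : forall m, (m <= k - 2)%nat ->
    J (a ++ [1%nat]) (b ++ [(k - 1)%nat]) =
    sum_list (seq 1 m) (fun i =>
      (-1) ^ (i - 1) * T (a ++ [(i + 1)%nat]) * T (b ++ [(k - i)%nat]))
    + (-1) ^ m * J (a ++ [(m + 1)%nat]) (b ++ [(k - 1 - m)%nat])).
  { induction m as [|m IH]; intros Hm.
    - unfold sum_list; simpl. rewrite Nat.sub_0_r. ring.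
    - rewrite IH, sum_list_seq_S by lia.
      assert (E := J_by_parts a b (m + 1) (k - 2 - m) Ha Hb).
      replace (S (k - 2 - m)) with (k - 1 - m)%nat in E by lia.
      replace (k - 1 - S m)%nat with (k - 2 - m)%nat by lia.
      replace (S m + 1)%nat with (S (m + 1)) by lia.
      replace (1 + m - 1)%nat with m by lia.
      replace (1 + m + 1)%nat with (S (m + 1)) by lia.
      replace (k - (1 + m))%nat with (k - 1 - m)%nat by lia.
      specialize (E ltac:(lia) ltac:(lia)).
      replace (J (a ++ [(m + 1)%nat]) (b ++ [(k - 1 - m)%nat])) with
        (T (a ++ [S (m + 1)]) * T (b ++ [(k - 1 - m)%nat]) -
         J (a ++ [S (m + 1)]) (b ++ [(k - 2 - m)%nat])) by (rewrite <- E; ring).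
      simpl. ring. }
  rewrite (H (k - 2)%nat) by lia. do 2 f_equal.
  - replace k with (S (S (k - 2))) at 2 by lia. simpl. ring.
  - replace (k - 2 + 1)%nat with (k - 1)%nat by lia.
    now replace (k - 1 - (k - 2))%nat with 1%nat by lia.
Qed.

Lemma bwd_S k r j : bwd k r (S j) = bwd k r j ++ [k (r - j)%nat].
Proof. unfold bwd. now rewrite seq_S, map_app. Qed.

Lemma fwd_S k n : fwd k (S n) = fwd k n ++ [k (S n)].
Proof. unfold fwd. now rewrite seq_S, map_app. Qed.

Lemma Ksum_S k r j : Ksum k r (S j) = (Ksum k r j + k (r - j)%nat)%nat.
Proof. unfold Ksum. rewrite bwd_S, list_sum_app. simpl. lia. Qed.

Lemma bwd_cons k r j : bwd k (S r) (S j) = k (S r) :: bwd k r j.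
Proof.
  unfold bwd. cbn [seq map]. rewrite Nat.sub_0_r, <- seq_shift, map_map. reflexivity.
Qed.

(** Identifies |k| with K_r, the exponent of the sign that the telescoping produces. *)
Lemma Ksum_total k r : Ksum k r r = list_sum (fwd k r).
Proof.
  unfold Ksum. induction r as [|r IH]; [reflexivity|].
  rewrite bwd_cons, fwd_S, list_sum_app. simpl. lia.
Qed.

Lemma bwd_positive k r j : (forall i, (1 <= i <= r)%nat -> (2 <= k i)%nat) ->
  (j <= r)%nat -> positive_index (bwd k r j).
Proof.
  intros hk Hj. apply Forall_map, List.Forall_forall. intros i Hi.
  apply in_seq in Hi. specialize (hk (r - i)%nat). lia.
Qed.

Lemma fwd_positive k r n : (forall i, (1 <= i <= r)%nat -> (2 <= k i)%nat) ->
  (n <= r)%nat -> positive_index (fwd k n).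
Proof.
  intros hk Hn. apply Forall_map, List.Forall_forall. intros i Hi.
  apply in_seq in Hi. specialize (hk i). lia.
Qed.

(** Row j leads from S j to E j at the cost of a sign (-1)^(e j), and a bracket L j leads on to S (j
    + 1). The signs accumulate to (-1)^(K j). The last row has no bracket after it, hence the
    different lengths of the two sums. *)
Lemma alternating_telescope (S P E L : nat -> R) (K : nat -> nat) (e : nat -> nat) n :
  K 0%nat = 0%nat -> (forall j, K (j + 1)%nat = (K j + e j)%nat) ->
  (forall j, (j <= n)%nat -> S j = P j + (-1) ^ e j * E j) ->
  (forall j, (j < n)%nat -> E j = L j + S (j + 1)%nat) ->
  S 0%nat - (-1) ^ K (n + 1)%nat * E n =
  sum_list (seq 0 (n + 1)) (fun j => (-1) ^ K j * P j)
  + sum_list (seq 0 n) (fun j => (-1) ^ K (j + 1)%nat * L j).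
Proof.
  intros HK0 HK HS HE.
  assert (H : forall m, (m <= n)%nat ->
    S 0%nat = sum_list (seq 0 m) (fun j => (-1) ^ K j * P j)
      + sum_list (seq 0 m) (fun j => (-1) ^ K (j + 1)%nat * L j) + (-1) ^ K m * S m).
  { induction m as [|m IH]; intros Hm.
    - unfold sum_list; simpl. rewrite HK0. simpl. ring.
    - rewrite IH, !sum_list_seq_S by lia. rewrite Nat.add_0_l.
      rewrite (HS m), (HE m) by lia. rewrite <- (Nat.add_1_r m).
      rewrite HK, pow_add. ring. }
  rewrite (H n) by lia. rewrite Nat.add_1_r at 2. rewrite sum_list_seq_S, HS by lia.
  rewrite HK, pow_add, Nat.add_0_l. ring.
Qed.

Theorem theorem3p6 (p q r : nat) (k : nat -> nat)
  (hp : (1 <= p)%nat) (hq : (1 <= q)%nat) (hr : (1 <= r)%nat)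
  (hk : forall i : nat, (1 <= i <= r)%nat -> (2 <= k i)%nat) :
  exists L : nat -> R,
    (forall j : nat, (j < r - 1)%nat ->
       filterlim
         (fun x : R =>
            A (idx_a p r k j) x * A (idx_b q r k j ++ [1%nat]) x
            - A (idx_a p r k j ++ [1%nat]) x * A (idx_b q r k j) x)
         (at_left 1) (locally (L j))) /\
    psi (ones (q - 1) ++ fwd k (r - 1) ++ [(k r - 1)%nat]) (INR p + 1)
    - (-1) ^ list_sum (fwd k r)
      * psi (ones (p - 1) ++ bwd k r (r - 1) ++ [(k 1%nat - 1)%nat]) (INR q + 1)
    = sum_list (seq 0 r) (fun j =>
        (-1) ^ Ksum k r j *
        sum_list (seq 1 (k (r - j)%nat - 2)) (fun i =>
          (-1) ^ (i - 1)
          * T (ones (p - 1) ++ bwd k r j ++ [(i + 1)%nat])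
          * T (ones (q - 1) ++ fwd k (r - j - 1) ++ [(k (r - j)%nat - i)%nat])))
      + sum_list (seq 0 (r - 1)) (fun j => (-1) ^ Ksum k r (j + 1) * L j).
Proof.
  (* Here [a j] carries j entries of the reversed index, so [idx_a p r k j] is [a (j + 1)], while
     [idx_b q r k j] is [b j]. *)
  set (a := fun j => ones (p - 1) ++ bwd k r j).
  set (b := fun j => ones (q - 1) ++ fwd k (r - j - 1)).
  set (e := fun j => k (r - j)%nat).
  set (S' := fun j => J (a j ++ [1%nat]) (b j ++ [(e j - 1)%nat])).
  set (E := fun j => J (a j ++ [(e j - 1)%nat]) (b j ++ [1%nat])).
  assert (Ha : forall j, (j <= r)%nat -> positive_index (a j)).
  { intros j Hj. apply positive_index_app; [apply ones_positive|now apply bwd_positive]. }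
  assert (Hb : forall j, positive_index (b j)).
  { intros j. apply positive_index_app; [apply ones_positive|].
    apply (fwd_positive k r); [exact hk|lia]. }
  assert (He : forall j, (j < r)%nat -> (2 <= e j)%nat) by (intros j Hj; apply hk; lia).
  (* The limits are named by their values as differences of integrals, so the link from row j to row
     j + 1 holds by construction. *)
  exists (fun j => E j - S' (j + 1)%nat). split.
  - intros j Hj.
    assert (Eb : idx_b q r k j = b (j + 1)%nat ++ [S (e (j + 1)%nat - 1)]).
    { unfold idx_b, b, e. replace (r - j - 1)%nat with (S (r - (j + 1) - 1)) by lia.
      rewrite fwd_S, app_assoc. do 2 f_equal.
      replace (S (r - (j + 1) - 1)) with (r - (j + 1))%nat by lia.
      specialize (hk (r - (j + 1))%nat). lia. }
    assert (Eb' : b j = b (j + 1)%nat ++ [S (e (j + 1)%nat - 1)]) by exact Eb.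
    assert (Ea : idx_a p r k j = a j ++ [S (e j - 1)]).
    { unfold idx_a, a, e. rewrite Nat.add_1_r, bwd_S, app_assoc. do 2 f_equal.
      specialize (hk (r - j)%nat). lia. }
    assert (Ea' : a (j + 1)%nat = a j ++ [S (e j - 1)]) by exact Ea.
    assert (H1 := He j ltac:(lia)). assert (H2 := He (j + 1)%nat ltac:(lia)).
    assert (H := J_bracket (a j) (b (j + 1)%nat) (e j - 1) (e (j + 1)%nat - 1)
                   (Ha j ltac:(lia)) (Hb _) ltac:(lia) ltac:(lia)).
    rewrite <- Eb', <- Ea' in H. fold (E j) in H. fold (S' (j + 1)%nat) in H.
    refine (filterlim_ext_loc _ _ _ (filterlim_comp _ _ _ _ _ _ _ _ two_artanh_lim H)).
    generalize at_left_1_01. apply filter_imp. intros x Hx.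
    unfold Ah. rewrite tanh_two_artanh by exact Hx. reflexivity.
  - assert (Hp1 : ones p = ones (p - 1) ++ [1%nat])
      by (rewrite <- ones_S; f_equal; lia).
    assert (Hq1 : ones q = ones (q - 1) ++ [1%nat])
      by (rewrite <- ones_S; f_equal; lia).
    (* The two psi terms are the ends of the chain: in row 0 the first index with its entry 1 is
       [ones p], and in row r - 1 the second one is [ones q], which calls for the symmetry of
       [J]. *)
    assert (Hpsi1 : psi (ones (q - 1) ++ fwd k (r - 1) ++ [(k r - 1)%nat]) (INR p + 1)
                    = S' 0%nat).
    { rewrite app_assoc, psi_J; [|apply positive_index_app|exact hp].
      - unfold S', a, b, e. rewrite Hp1, !Nat.sub_0_r. unfold bwd. simpl.
        now rewrite app_nil_r.
      - replace (r - 1)%nat with (r - 0 - 1)%nat by lia. apply Hb.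
      - apply positive_index_1. specialize (hk r). lia. }
    assert (Hpsi2 : psi (ones (p - 1) ++ bwd k r (r - 1) ++ [(k 1%nat - 1)%nat]) (INR q + 1)
                    = E (r - 1)%nat).
    { assert (H1 : positive_index [(k 1%nat - 1)%nat])
        by (apply positive_index_1; specialize (hk 1%nat); lia).
      assert (H2 : positive_index (a (r - 1)%nat)) by (apply Ha; lia).
      rewrite app_assoc, psi_J; [|now apply positive_index_app|exact hq].
      rewrite J_sym; [|apply ones_positive|now apply positive_index_app
                      |rewrite Hq1; now destruct (ones (q - 1))].
      unfold E, b, e. replace (r - (r - 1))%nat with 1%nat by lia.
      rewrite Hq1. simpl. now rewrite app_nil_r. }
    rewrite Hpsi1, Hpsi2, <- Ksum_total.
    assert (H := alternating_telescope S'
      (fun j => sum_list (seq 1 (e j - 2)) (fun i =>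
          (-1) ^ (i - 1) * T (a j ++ [(i + 1)%nat]) * T (b j ++ [(e j - i)%nat])))
      E (fun j => E j - S' (j + 1)%nat) (Ksum k r) e (r - 1)).
    replace (r - 1 + 1)%nat with r in H by lia. rewrite H.
    + f_equal. apply sum_list_ext. intros j _. f_equal. apply sum_list_ext.
      intros i _. unfold a, b, e. now rewrite !app_assoc.
    + reflexivity.
    + intros j. now rewrite Nat.add_1_r, Ksum_S.
    + intros j Hj. exact (J_chain (a j) (b j) (e j) (Ha j ltac:(lia)) (Hb j) (He j ltac:(lia))).
    + intros j _. ring.
Qed.
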